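(* It can happen that, for a $\mathscr{V}$-path $\alpha_0,\beta_0,\alpha_1$ in $\mathcal{N}_n$ (with $\mathscr{V}$ the discrete vector field on $\mathcal{N}_n$ constructed in the context), $\alpha_0$ and $\beta_0$ are first paired in $\mathscr{V}_i$ for some $i\ge 3$, while $\alpha_1$ is not paired at all in $\mathscr{V}$ (so that $\alpha_1$ is a critical simplex). Specifically, for $n=4$, consider the graphs on $\{1,2,3,4\}$ with edge sets $$\alpha_0=\{(2,4),(3,4)\},\qquad \beta_0=\{(2,4),(3,4),(2,3)\}.$$ Then $(\alpha_0,\beta_0)\in\mathscr{V}_3\setminus\mathscr{V}_{12}$; there are exactly two choices of $\alpha_1$ for which $\alpha_0,\beta_0,\alpha_1$ is a $\mathscr{V}$-path, namely $\alpha_1=\{(2,4),(2,3)\}$ and $\alpha_1=\{(3,4),(2,3)\}$; and both of these are unpaired in $\mathscr{V}$.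
   Context: Graphs. A graph of order $n$ is a simple, undirected, labelled graph on the vertex set $\{1,\ldots,n\}$; it is identified with its edge set $E(G)$, a set of 2-subsets of $\{1,\ldots,n\}$. The edge joining $i$ and $j$ is written $(i,j)=(j,i)$. If $(i,j)\notin E(G)$, then $G+(i,j)$ is the graph of order $n$ with edge set $E(G)\cup\{(i,j)\}$. The complex. $\mathcal{N}_n$ is the abstract simplicial complex whose simplices are the (edge sets of) disconnected graphs of order $n$ (the empty set is included as a simplex); the dimension of a simplex $\sigma$ is $|\sigma|-1$. Discrete vector fields. A discrete vector field on a complex $\mathcal{K}$ is a collection $\mathscr{W}$ of ordered pairs $(\alpha,\beta)$ of simplices of $\mathcal{K}$ with $\alpha\subsetneq\beta$ and $\dim\beta=\dim\alpha+1$, such that each simplex of $\mathcal{K}$ is in at most one pair. A simplex is unpaired in $\mathscr{W}$ if it is in no pair of $\mathscr{W}$. A nonempty simplex is critical with respect to $\mathscr{W}$ if it is unpaired in $\mathscr{W}$, or it is a $0$-simplex $\alpha$ with $(\emptyset,\alpha)\in\mathscr{W}$. A $\mathscr{W}$-path is a sequence of simplices $\alpha_0^{(d)},\beta_0^{(d+1)},\alpha_1^{(d)},\ldots,\alpha_k^{(d)},\beta_k^{(d+1)},\alpha_{k+1}^{(d)}$ (superscripts denote dimension) such that for each $i\in\{0,\ldots,k\}$, $(\alpha_i,\beta_i)\in\mathscr{W}$ and $\beta_i\supsetneq\alpha_{i+1}\neq\alpha_i$. Construction of $\mathscr{V}$. Put $$\mathscr{V}_2:=\mathscr{V}_{12}:=\{(G,G+(1,2))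 : G\in\mathcal{N}_n,\ (1,2)\notin E(G),\ G+(1,2)\in\mathcal{N}_n\}.$$ For $i=3,4,\ldots,n$ in increasing order, $\mathscr{V}_i$ is obtained from $\mathscr{V}_{i-1}$ by adding all pairs $(G,G+(j,i))$ with $1\le j<i$, $(j,i)\notin E(G)$, such that $G$ and $G+(j,i)$ both belong to $\mathcal{N}_n$ and are both unpaired in $\mathscr{V}_{i-1}$ (for a given $G$ unpaired in $\mathscr{V}_{i-1}$ there is at most one such $j$). Finally $\mathscr{V}:=\mathscr{V}_n$. A simplex (or pair) is first paired in $\mathscr{V}_i$ ($i\ge3$) if it is paired in $\mathscr{V}_i$ but not in $\mathscr{V}_{i-1}$. *)

(* Defs.v *)
From HB Require Import structures.
From mathcomp Require Import all_boot all_order all_algebra.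

Set Implicit Arguments.
Unset Strict Implicit.
Unset Printing Implicit Defensive.

Import Order.TTheory GRing.Theory Num.Theory.

Section Complexes.
Variable T : finType.
Implicit Types (K : {set {set T}}) (W : {set {set T} * {set T}}) (s : {set T}).

(* An integer, so that the empty simplex has dimension -1. *)
Definition dim s : int := (#|s|%:Z - 1)%R.

Definition paired W s : bool := [exists p in W, (s == p.1) || (s == p.2)].

Definition unpaired W s : bool := ~~ paired W s.

Definition critical K W s : bool :=
  [&& s \in K, s != set0
    & unpaired W s || ((dim s == 0%R) && ((set0, s) \in W))].

Definition path_step K W (d : int) (a b a' : {set T}) : bool :=
  [&& a \in K, b \in K, a' \in K,
      dim a == d, dim b == (d + 1)%R, dim a' == d,
      (a, b) \in W, a' \proper b & a' != a].

Fixpoint path_steps K W (d : int) (a : {set T})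
    (bs : seq ({set T} * {set T})) : bool :=
  if bs is (b, a') :: bs' then
    path_step K W d a b a' && path_steps K W d a' bs'
  else true.

(* The W-path a_0, b_0, a_1, ..., b_k, a_{k+1} is encoded by a_0 together with
   the nonempty sequence [:: (b_0, a_1); ...; (b_k, a_{k+1})]. *)
Definition gradient_path K W (a : {set T})
    (bs : seq ({set T} * {set T})) : bool :=
  (bs != [::]) && path_steps K W (dim a) a bs.

End Complexes.

Section DisconnectedGraphs.
Variable n : nat.

(* The vertex labelled k, for 1 <= k <= n, is the ordinal of value k - 1.
   A graph of order n is given by its edge set, all of whose members must be
   2-subsets (is_graph). *)
Implicit Types (G : {set {set 'I_n}}).

Definition is_graph G : bool := [forall e in G, #|e| == 2].

Definition adj G : rel 'I_n := fun u v => [set u; v] \in G.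

Definition connected_graph G : bool :=
  [forall u, forall v, connect (adj G) u v].

Definition NN : {set {set {set 'I_n}}} :=
  [set G | is_graph G && ~~ connected_graph G].

(* The edge (i, j), in terms of the labels i <> j in {1, ..., n}. *)
Definition edge (i j : nat) : {set 'I_n} :=
  [set v : 'I_n | (v.+1 == i) || (v.+1 == j)].

Definition add_edge G (i j : nat) : {set {set 'I_n}} := edge i j |: G.

Definition V12 : {set {set {set 'I_n}} * {set {set 'I_n}}} :=
  [set p : {set {set 'I_n}} * {set {set 'I_n}} |
    [&& p.1 \in NN, edge 1 2 \notin p.1,
        p.2 == add_edge p.1 1 2 & p.2 \in NN]].

Definition new_pairs (W : {set {set {set 'I_n}} * {set {set 'I_n}}}) (i : nat) :
    {set {set {set 'I_n}} * {set {set 'I_n}}} :=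
  [set p : {set {set 'I_n}} * {set {set 'I_n}} | [exists j : 'I_i,
     [&& 1 <= j, edge j i \notin p.1, p.2 == add_edge p.1 j i,
         p.1 \in NN, p.2 \in NN, unpaired W p.1 & unpaired W p.2]]].

(* V_ i is meaningful for 2 <= i <= n; V_ 0 and V_ 1 are set to V12. *)
Fixpoint V_ (i : nat) : {set {set {set 'I_n}} * {set {set 'I_n}}} :=
  if i is i'.+1 then
    if 2 <= i' then V_ i' :|: new_pairs (V_ i') i'.+1 else V12
  else V12.

Definition VV : {set {set {set 'I_n}} * {set {set 'I_n}}} := V_ n.

(* To be used for 3 <= i <= n. *)
Definition first_paired (i : nat) G : bool :=
  paired (V_ i) G && unpaired (V_ i.-1) G.

End DisconnectedGraphs.

(* Main.v *)
(** Write ij for the edge (i, j).  The faces of the triangle b0 = {24, 34, 23}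
    are a0 = {24, 34}, c1 = {24, 23} and c2 = {34, 23}.  All four graphs isolate
    the vertex 1 and become connected when 12 is added, so none of them is paired
    in V_12; hence 23 pairs a0 with b0 in V_3.  A graph could be paired with c1 or
    c2 after V_12 only if it is obtained by deleting an edge, which leaves a single
    edge, already paired in V_12; by adding an edge at the vertex 1, which gives a
    connected graph; or by completing the triangle at stage 4, which gives b0,
    already paired in V_3. *)
Require Import Defs.
From mathcomp Require Import all_boot all_order all_algebra.

Set Implicit Arguments.
Unset Strict Implicit.
Unset Printing Implicit Defensive.

(** * Paired and unpaired sets for an arbitrary collection of pairs *)

Section Pairing.
Variable T : finType.
Implicit Types (W : {set {set T} * {set T}}) (s : {set T}).

Lemma unpairedP W s :
  reflect (forall p, p \in W -> s <> p.1 /\ s <> p.2) (unpaired W s).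
Proof.
apply: (iffP idP) => [/existsPn unps p Wp | unps].
  by have := unps p; rewrite Wp /= negb_or => /andP[/eqP ? /eqP ?].
apply/existsPn => p; apply/negP => /andP[/unps[s1 s2]].
by case/orP => /eqP.
Qed.

Lemma pairedl W s t : (s, t) \in W -> paired W s.
Proof. by move=> Wst; apply/existsP; exists (s, t); rewrite Wst /= eqxx. Qed.

Lemma pairedr W s t : (s, t) \in W -> paired W t.
Proof. by move=> Wst; apply/existsP; exists (s, t); rewrite Wst /= eqxx orbT. Qed.

Lemma unpairedU W W' s : unpaired (W :|: W') s = unpaired W s && unpaired W' s.
Proof.
apply/idP/andP => [/unpairedP unps | [/unpairedP unpW /unpairedP unpW']].
  by split; apply/unpairedP => p Wp; apply: unps; rewrite inE Wp ?orbT.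
by apply/unpairedP => p; rewrite inE => /orP[/unpW|/unpW'].
Qed.

Lemma pairedS W W' s : W \subset W' -> paired W s -> paired W' s.
Proof.
move=> /subsetP sWW' /existsP[p /andP[Wp sp]].
by apply/existsP; exists p; rewrite sWW'.
Qed.

End Pairing.

(** * Graphs given by lists of labelled edges; connectivity certificates *)

Section Graphs.
Variable n : nat.
Implicit Types (G : {set {set 'I_n}}) (s : seq (nat * nat)).

Lemma unpaired_V12 G : edge n 1 2 \notin G -> add_edge G 1 2 \notin NN n ->
  unpaired (V12 n) G.
Proof.
move=> G12 NG; apply/unpairedP => p; rewrite inE => /and4P[_ _ /eqP p2 N2].
by split=> eG; move: G12 NG; rewrite eG -?p2 ?N2 // p2 setU11.
Qed.

Lemma paired_V12 G : G \in NN n -> edge n 1 2 \notin G ->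
  add_edge G 1 2 \in NN n -> paired (V12 n) G.
Proof.
by move=> NG G12 NG'; apply: (@pairedl _ _ _ (add_edge G 1 2)); rewrite inE /= NG G12 eqxx.
Qed.

(** For each [j] the only possible partner of [G] at stage [i] is [G] with the edge [(j, i)]
    toggled; the hypothesis rules that partner out as connected or already paired. *)
Lemma unpaired_new_pairs (W : {set {set {set 'I_n}} * {set {set 'I_n}}}) i G :
  (forall j, 1 <= j < i -> if edge n j i \in G then paired W (G :\ edge n j i)
     else (add_edge G j i \notin NN n) || paired W (add_edge G j i)) ->
  unpaired (new_pairs W i) G.
Proof.
move=> HG; apply/unpairedP => p; rewrite inE => /existsP[j].
case/and5P=> j0 e1 /eqP p2 N1 /and3P[N2 u1 u2].
have := HG j; rewrite j0 ltn_ord => /(_ isT) {}HG; split=> eG; move: HG.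
  by rewrite eG (negPf e1) -p2 N2 /=; apply/negP.
by rewrite eG p2 setU11 setU1K //; apply/negP.
Qed.

(** Unlike equality of the sets [edge n i j], this test on labels evaluates by computation; only the
    labels from 1 to [n] are compared, since no others occur in an edge. *)
Definition same_edge (p q : nat * nat) : bool :=
  all (fun k => ((k == p.1) || (k == p.2)) == ((k == q.1) || (k == q.2)))
    (iota 1 n).

Lemma eq_edge i j k l : (edge n i j == edge n k l) = same_edge (i, j) (k, l).
Proof.
apply/eqP/allP => [/setP eqe m | eqe].
  rewrite mem_iota add1n ltnS; case: m => // m /andP[_ ltmn] /=.
  by have := eqe (Ordinal ltmn); rewrite !inE /= => ->.
apply/setP => v; rewrite !inE; apply/eqP; apply: (eqe (val v).+1).
by rewrite mem_iota add1n /= ltnS ltn_ord.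
Qed.

Lemma adjE G u v : adj G u v = (edge n u.+1 v.+1 \in G).
Proof.
rewrite /adj (_ : [set u; v] = edge n u.+1 v.+1) //.
by apply/setP => w; rewrite !inE !eqSS.
Qed.

Lemma adj_sym G : symmetric (adj G).
Proof. by move=> u v; rewrite /adj setUC. Qed.

Definition mkgraph s : {set {set 'I_n}} :=
  [set e in [seq edge n p.1 p.2 | p <- s]].

Lemma mem_mkgraph i j s :
  (edge n i j \in mkgraph s) = has (same_edge (i, j)) s.
Proof.
rewrite inE; elim: s => //= -[k l] s IH.
by rewrite inE IH eq_edge.
Qed.

Lemma add_edge_mkgraph s i j : add_edge (mkgraph s) i j = mkgraph ((i, j) :: s).
Proof. by apply/setP => e; rewrite !inE. Qed.

Lemma mkgraphD1 s i j : mkgraph s :\ edge n i j =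
  mkgraph [seq p <- s | ~~ same_edge (i, j) p].
Proof.
apply/setP => e; rewrite !inE; elim: s => [|[k l] s IH] /=; first by rewrite andbF.
rewrite -eq_edge inE andb_orr IH.
case: (eqVneq (edge n i j)) => [<-|ne] /=; first by rewrite andNb.
rewrite inE; case: (eqVneq e (edge n k l)) => [->|_]; last by rewrite andbF.
by rewrite eq_sym ne.
Qed.

Lemma card_mkgraph s : pairwise (fun p q => ~~ same_edge p q) s ->
  #|mkgraph s| = size s.
Proof.
move=> pws; rewrite cardsE -(size_map (fun p => edge n p.1 p.2)); apply/card_uniqP.
rewrite uniq_pairwise pairwise_map; apply: sub_pairwise pws => -[i j] [k l] /=.
by rewrite /= eq_edge.
Qed.

Lemma card_edge i j : 0 < i <= n -> 0 < j <= n -> i != j -> #|edge n i j| = 2.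
Proof.
case: i j => [//|i] [//|j] /andP[_ ltin] /andP[_ ltjn]; rewrite eqSS => ij.
rewrite (_ : edge n _ _ = [set Ordinal ltin; Ordinal ltjn]); first by rewrite cards2 ij.
by apply/setP => v; rewrite !inE !eqSS.
Qed.

(* [f] is the indicator of a union of connected components. *)
Lemma mkgraph_NN (f : pred nat) s :
    all (fun p => [&& 0 < p.1 <= n, 0 < p.2 <= n, p.1 != p.2 & f p.1 == f p.2]) s ->
    has f (iota 1 n) -> ~~ all f (iota 1 n) ->
  mkgraph s \in NN n.
Proof.
move=> /allP sP /hasP[u + fu] /allPn[v + fv]; rewrite !mem_iota !add1n !ltnS.
case: u v fu fv => [//|u] [//|v] fu fv /andP[_ ltun] /andP[_ ltvn].
rewrite inE; apply/andP; split.
  apply/forall_inP => e; rewrite inE => /mapP[p /sP/and4P[p1 p2 np _] ->].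
  by rewrite card_edge.
apply/negP => /forallP/(_ (Ordinal ltun))/forallP/(_ (Ordinal ltvn)) uv.
(* The two ends of every edge have the same value of [f], so no chain of edges leads from [u], where
   [f] holds, to [v], where it fails. *)
have cl : closed (adj (mkgraph s)) [pred w : 'I_n | f w.+1].
  move=> x y /[!adjE] /[!inE] /mapP[p /sP/and4P[_ _ _ /eqP fp] /setP eqe].
  have := eqe x; have := eqe y; rewrite !inE !eqxx orbT /=.
  by do 2!case/esym/orP => /eqP->.
by have := closed_connect cl uv; rewrite !inE /= fu (negPf fv).
Qed.

(** The walk joins its start [i] to every vertex, and adjacency is symmetric. Vertices may be
    repeated, so a branching graph also has such a walk. *)
Lemma walk_connected G i (w : seq nat) :
    path (fun k l => edge n k l \in G) i w ->
    all (fun k => 0 < k <= n) (i :: w) ->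
    {subset iota 1 n <= i :: w} ->
  connected_graph G.
Proof.
move=> pathw rw cov.
have conn (u v : 'I_n) : u.+1 = i -> v.+1 \in i :: w -> connect (adj G) u v.
  elim: w i u pathw rw {cov} => [|j w IH] i u /=.
    by move=> _ _ ui; rewrite inE -ui eqSS => /eqP/val_inj->.
  case/andP=> ij pathw /and3P[_ j_n rw] ui; rewrite inE => /orP[].
    by rewrite -ui eqSS => /eqP/val_inj->.
  case: j j_n ij pathw => [//|j] /andP[_ ltjn] ij pathw vw.
  apply: (connect_trans (y := Ordinal ltjn)).
    by apply: connect1; rewrite adjE ui.
  by apply: IH vw => //=; rewrite ltjn.
case: i rw pathw conn cov => [//|i] /andP[/andP[_ ltin] _] _ conn cov.
have {}conn v : connect (adj G) (Ordinal ltin) v.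
  by apply: conn => //; apply: cov; rewrite mem_iota add1n /= ltnS ltn_ord.
apply/forallP => u; apply/forallP => v; apply: connect_trans (conn v).
by rewrite (sym_connect_sym (@adj_sym G)).
Qed.

Lemma mkgraph_notin_NN s i (w : seq nat) :
    path (fun k l => has (same_edge (k, l)) s) i w ->
    all (fun k => 0 < k <= n) (i :: w) -> all (mem (i :: w)) (iota 1 n) ->
  mkgraph s \notin NN n.
Proof.
move=> pathw rw /allP cov; rewrite inE negb_and negbK; apply/orP; right.
apply: walk_connected rw cov.
by apply: sub_path pathw => k l; rewrite mem_mkgraph.
Qed.

Lemma set2_mkgraph i j k l :
  [set edge n i j; edge n k l] = mkgraph [:: (i, j); (k, l)].
Proof. by apply/setP => e; rewrite !inE. Qed.

Lemma set3_mkgraph i j k l i' j' :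
  [set edge n i j; edge n k l; edge n i' j'] = mkgraph [:: (i, j); (k, l); (i', j')].
Proof. by apply/setP => e; rewrite !inE orbA. Qed.

End Graphs.

(** * The triangle on 2, 3, 4 and its three faces *)

Local Notation graph_a0 := (mkgraph 4 [:: (2, 4); (3, 4)]).
Local Notation graph_b0 := (mkgraph 4 [:: (2, 4); (3, 4); (2, 3)]).
Local Notation graph_c1 := (mkgraph 4 [:: (2, 4); (2, 3)]).
Local Notation graph_c2 := (mkgraph 4 [:: (3, 4); (2, 3)]).

Lemma isolated1_NN s :
  all (fun p => [&& 1 < p.1 <= 4, 1 < p.2 <= 4 & p.1 != p.2]) s ->
  mkgraph 4 s \in NN 4.
Proof.
move=> sP; apply: (@mkgraph_NN 4 (pred1 1)) => //; apply: sub_all sP => -[i j] /=.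
by case: i j => [|[|i]] [|[|j]] //= /and3P[-> -> ->].
Qed.

Lemma unpaired_V12_walk s (w : seq nat) :
    ~~ has (same_edge 4 (1, 2)) s ->
    path (fun k l => has (same_edge 4 (k, l)) ((1, 2) :: s)) 1 w ->
    all (fun k => 0 < k <= 4) w -> all (mem (1 :: w)) (iota 1 4) ->
  unpaired (V12 4) (mkgraph 4 s).
Proof.
move=> s12 pathw rw cov; apply: unpaired_V12; rewrite ?mem_mkgraph //.
by rewrite add_edge_mkgraph; apply: mkgraph_notin_NN pathw _ cov.
Qed.

Lemma single_paired_V12 p :
  p \in [:: (2, 3); (2, 4); (3, 4)] -> paired (V12 4) (mkgraph 4 [:: p]).
Proof.
move=> p_in.
have pP : [&& 1 < p.1 <= 4, 1 < p.2 <= 4 & p.1 != p.2] by move: p p_in; apply/allP.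
apply: paired_V12.
- by apply: isolated1_NN; rewrite /= pP.
- by rewrite mem_mkgraph; move: p p_in {pP}; apply/allP.
rewrite add_edge_mkgraph.
(* The component of 1 once 12 is added: [{1, 2}], together with the other end of [p] when [p] starts
   at 2. It always misses 3 or 4. *)
apply: (@mkgraph_NN 4 (fun k => (k < 3) || (p.1 == 2) && (k == p.2))).
all: by move: p p_in {pP}; apply/allP.
Qed.

Lemma a0_unpaired_V12 : unpaired (V12 4) graph_a0.
Proof. exact: (@unpaired_V12_walk _ [:: 2; 4; 3]). Qed.

Lemma b0_unpaired_V12 : unpaired (V12 4) graph_b0.
Proof. exact: (@unpaired_V12_walk _ [:: 2; 4; 3]). Qed.

Lemma c1_unpaired_V12 : unpaired (V12 4) graph_c1.
(* With 12 added the graph is a star centred at 2, so the walk passes through 2 twice. *)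
Proof. exact: (@unpaired_V12_walk _ [:: 2; 4; 2; 3]). Qed.

Lemma c2_unpaired_V12 : unpaired (V12 4) graph_c2.
Proof. exact: (@unpaired_V12_walk _ [:: 2; 3; 4]). Qed.

Lemma a0_b0_V3 : (graph_a0, graph_b0) \in V_ 4 3.
Proof.
rewrite in_setU; apply/orP; right; rewrite inE; apply/existsP; exists (@Ordinal 3 2 isT).
rewrite /= a0_unpaired_V12 b0_unpaired_V12 !isolated1_NN // mem_mkgraph /=.
rewrite add_edge_mkgraph !andbT; apply/eqP/setP => e; rewrite !inE.
by do 3!case: (e == _).
Qed.

Lemma unpaired_VV4 G : unpaired (VV 4) G =
  [&& unpaired (V12 4) G, unpaired (new_pairs (V_ 4 2) 3) G
    & unpaired (new_pairs (V_ 4 3) 4) G].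
Proof. by rewrite /VV /= !unpairedU andbA. Qed.

Lemma c1_unpaired : unpaired (VV 4) graph_c1.
Proof.
rewrite unpaired_VV4 c1_unpaired_V12 /=; apply/andP; split.
  (* Stage 3: adding 13 connects the graph, and deleting 23 leaves 24 alone. *)
  apply: unpaired_new_pairs => -[|[|[|]]] // _; rewrite mem_mkgraph /=.
    by rewrite add_edge_mkgraph (@mkgraph_notin_NN _ _ 1 [:: 3; 2; 4]).
  by rewrite mkgraphD1 /= single_paired_V12.
(* Stage 4: adding 14 connects the graph, deleting 24 leaves 23 alone, and adding 34 completes the
   triangle. *)
apply: unpaired_new_pairs => -[|[|[|[|]]]] // _; rewrite mem_mkgraph /=.
- by rewrite add_edge_mkgraph (@mkgraph_notin_NN _ _ 1 [:: 4; 2; 3]).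
- rewrite mkgraphD1 /=; apply: pairedS (subsetUl _ _) _.
  exact: single_paired_V12.
rewrite (_ : add_edge _ 3 4 = graph_b0) ?(pairedr a0_b0_V3) ?orbT //.
by rewrite add_edge_mkgraph; apply/setP => e; rewrite !inE orbCA.
Qed.

Lemma c2_unpaired : unpaired (VV 4) graph_c2.
Proof.
rewrite unpaired_VV4 c2_unpaired_V12 /=; apply/andP; split.
  apply: unpaired_new_pairs => -[|[|[|]]] // _; rewrite mem_mkgraph /=.
    by rewrite add_edge_mkgraph (@mkgraph_notin_NN _ _ 1 [:: 3; 2; 3; 4]).
  by rewrite mkgraphD1 /= single_paired_V12.
(* Here 24 completes the triangle, while deleting 34 leaves 23 alone. *)
apply: unpaired_new_pairs => -[|[|[|[|]]]] // _; rewrite mem_mkgraph /=.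
- by rewrite add_edge_mkgraph (@mkgraph_notin_NN _ _ 1 [:: 4; 3; 2]).
- by rewrite add_edge_mkgraph (pairedr a0_b0_V3) orbT.
rewrite mkgraphD1 /=; apply: pairedS (subsetUl _ _) _.
exact: single_paired_V12.
Qed.

Lemma a0_neq_c1 : graph_a0 != graph_c1.
Proof.
apply/eqP => /setP/(_ (edge 4 3 4)).
by rewrite !mem_mkgraph.
Qed.

Lemma a0_neq_c2 : graph_a0 != graph_c2.
Proof.
apply/eqP => /setP/(_ (edge 4 2 4)).
by rewrite !mem_mkgraph.
Qed.

Lemma c1_neq_c2 : graph_c1 != graph_c2.
Proof.
apply/eqP => /setP/(_ (edge 4 2 4)).
by rewrite !mem_mkgraph.
Qed.

(** By dimension, [a1] is the triangle minus one edge; of the three such faces, the path condition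
    excludes only [graph_a0]. *)
Lemma a0_b0_path a1 :
  gradient_path (NN 4) (VV 4) graph_a0 [:: (graph_b0, a1)] <->
  a1 = graph_c1 \/ a1 = graph_c2.
Proof.
have W_a0_b0 : (graph_a0, graph_b0) \in VV 4 by rewrite in_setU a0_b0_V3.
have [b0_c2 b0_c1 b0_a0] : [/\ graph_b0 :\ edge 4 2 4 = graph_c2,
    graph_b0 :\ edge 4 3 4 = graph_c1 & graph_b0 :\ edge 4 2 3 = graph_a0].
  by split; rewrite mkgraphD1.
rewrite /gradient_path /= andbT /path_step /Defs.dim !card_mkgraph // W_a0_b0.
rewrite !isolated1_NN //=; split.
  case/and4P=> _ /eqP d1 a1b0 a1a0.
  (* Cancelling the [- 1] of [dim] turns the equality of integer dimensions into one of
     cardinalities. *)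
  have c_a1 : #|a1| = 2 by have [] := GRing.addIr _ d1.
  have [e eb0 ea1] : exists2 e, e \in graph_b0 & e \notin a1.
    by have [_ [e]] := properP a1b0; exists e.
  have : a1 = graph_b0 :\ e.
    apply/eqP; rewrite eqEcard subsetD1 (proper_sub a1b0) ea1 /= c_a1.
    by have := cardsD1 e graph_b0; rewrite eb0 card_mkgraph // add1n => -[<-].
  move: eb0 a1a0; rewrite !inE => /or3P[] /eqP-> /[swap] ->.
  - by rewrite b0_c2; right.
  - by rewrite b0_c1; left.
  - by rewrite b0_a0 eqxx.
case=> ->; rewrite isolated1_NN // card_mkgraph //= eq_sym ?a0_neq_c1 ?a0_neq_c2 andbT.
  by rewrite -b0_c1 properD1 // mem_mkgraph.
by rewrite -b0_c2 properD1 // mem_mkgraph.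
Qed.

Theorem mainTheorem3 :
  (exists (n : nat) (a0 b0 a1 : {set {set 'I_n}}) (i : nat),
     [/\ gradient_path (NN n) (VV n) a0 [:: (b0, a1)],
         3 <= i <= n,
         first_paired i a0 /\ first_paired i b0,
         unpaired (VV n) a1
       & critical (NN n) (VV n) a1])
  /\
  (let a0 : {set {set 'I_4}} := [set edge 4 2 4; edge 4 3 4] in
   let b0 : {set {set 'I_4}} := [set edge 4 2 4; edge 4 3 4; edge 4 2 3] in
   let c1 : {set {set 'I_4}} := [set edge 4 2 4; edge 4 2 3] in
   let c2 : {set {set 'I_4}} := [set edge 4 3 4; edge 4 2 3] in
   [/\ (a0, b0) \in V_ 4 3 :\: V12 4,
       c1 <> c2,
       (forall a1 : {set {set 'I_4}},
          gradient_path (NN 4) (VV 4) a0 [:: (b0, a1)] <-> a1 = c1 \/ a1 = c2)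
     & unpaired (VV 4) c1 /\ unpaired (VV 4) c2]).
Proof.
have V3_a0_b0 := a0_b0_V3.
split; last first.
  rewrite !set3_mkgraph !set2_mkgraph; split.
  - rewrite in_setD V3_a0_b0 andbT; apply/negP => /pairedl.
    exact/negP/a0_unpaired_V12.
  - exact/eqP/c1_neq_c2.
  - exact: a0_b0_path.
  - by split; [exact: c1_unpaired | exact: c2_unpaired].
exists 4, graph_a0, graph_b0, graph_c1, 3; split=> //.
- by apply/a0_b0_path; left.
(* For [i = 3] the preceding stage [V_ 4 2] reduces to [V12 4]. *)
- rewrite /first_paired (pairedl V3_a0_b0) (pairedr V3_a0_b0).
  by rewrite a0_unpaired_V12 b0_unpaired_V12.
- exact: c1_unpaired.
by rewrite /critical isolated1_NN // c1_unpaired -card_gt0 card_mkgraph.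
Qed.
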